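(* Let $\mathcal{X}$ be the set of prompts, $\mathcal{Y}$ the (countable) set of responses, and let $y \mapsto y^t$ be the map sending a response $y\in\mathcal{Y}$ to its target part. Let $r(x,y)$ be the reward function on full responses and $r_t(x,y^t)$ the reward function on target parts, and assume that the reward of a response is carried entirely by its target part, i.e. $r(x,y) = r_t(x,y^t)$ for every prompt $x\in\mathcal{X}$ and every response $y\in\mathcal{Y}$. Let $(\pi_\theta)_\theta$ be a parametrized family of policies, $\pi_{\mathrm{ref}}$ a reference policy, and $\beta>0$. Then preference learning remains equivalent when non-target tokens are excluded, in the following sense. For every prompt $x$, $$\mathbb{E}_{y\sim\pi_\theta(\cdot\mid x)}\left[r(x,y)\right] = \mathbb{E}_{y^t\sim\pi_\theta(\cdot\mid x)}\left[r_t(x,y^t)\right],$$ and consequently the policy gradient update of the target-restricted objective coincides with that of the original objective: $$\nabla_\theta\, \mathbb{E}_{y\sim\pi_\theta(\cdot\mid x)}\left[r(x,y) - \beta D_{\mathrm{KL}}\big(\pi_\theta(\cdot\mid x)\,\|\,\pi_{\mathrm{ref}}(\cdot\mid x)\big)\right] = \nabla_\theta\, \mathbb{E}_{y^t\sim\pi_\theta(\cdot\mid x)}\left[r_t(x,y^t) - \beta D_{\mathrm{KL}}\big(\pi_\theta(\cdot\mid x)\,\|\,\pi_{\mathrm{ref}}(\cdot\mid x)\big)\right].$$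
   Context: Prompts $x$ and responses $y$ are finite sequences of tokens. A policy $\pi$ assigns to each prompt $x$ a probability distribution $\pi(\cdot\mid x)$ on responses; $\pi_\theta$ is the policy being trained, depending on a real parameter vector $\theta$, and $\pi_{\mathrm{ref}}$ is a fixed reference policy. For a response $y$, the target part $y^t$ is the sub-collection of tokens of $y$ designated as target (e.g. the chunks of the response in which a hallucination occurs or is corrected); all other tokens are non-target tokens. The notation $y^t\sim\pi_\theta(\cdot\mid x)$ means that $y^t$ is distributed as the target part of a response $y\sim\pi_\theta(\cdot\mid x)$, i.e. according to the pushforward of $\pi_\theta(\cdot\mid x)$ under $y\mapsto y^t$. $D_{\mathrm{KL}}$ is the Kullback–Leibler divergence; it is computed with the full policies $\pi_\theta(\cdot\mid x)$ and $\pi_{\mathrm{ref}}(\cdot\mid x)$ in both objectives. Expectations, divergences and gradients are assumed to exist and be finite. *)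

(* Defs.v *)
From HB Require Import structures.
From mathcomp Require Import all_boot all_order all_algebra.
From mathcomp Require Import all_classical all_reals all_analysis.

Set Implicit Arguments.
Unset Strict Implicit.
Unset Printing Implicit Defensive.

Import Order.TTheory GRing.Theory Num.Theory.
Import numFieldNormedType.Exports.

Local Open Scope classical_set_scope.
Local Open Scope ring_scope.

(* [discrete T] is [T] with the sigma-algebra of all its subsets. *)
Definition discrete (T : Type) : Type := T.

HB.instance Definition _ (T : pointedType) := Pointed.on (discrete T).
HB.instance Definition _ (T : pointedType) :=
  @isMeasurable.Build default_measure_display (discrete T)
    (discrete_measurable (T := discrete T)) discrete_measurable0
    discrete_measurableC discrete_measurableU.

Lemma discrete_measurable_fun (d : measure_display) (T : pointedType)
    (T' : measurableType d) (f : discrete T -> T') : measurable_fun setT f.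
Proof. by []. Qed.

Definition discrete_mfun (d : measure_display) (T : pointedType)
    (T' : measurableType d) (f : discrete T -> T') : {mfun discrete T >-> T'} :=
  HB.pack f (isMeasurableFun.Build _ _ _ _ f (discrete_measurable_fun f)).

Definition policy (R : realType) (X : Type) (Y : pointedType) : Type :=
  X -> probability (discrete Y) R.

(* The law of the target part [tgt y] of a response [y] drawn from [P]. *)
Definition target_law (R : realType) (Y T : pointedType) (tgt : Y -> T)
    (P : probability (discrete Y) R) : probability (discrete T) R :=
  distribution P (discrete_mfun (tgt : discrete Y -> discrete T)).

(* For countable [Y], sum_y P(y) ln (P(y) / Q(y)), with value +oo when [P] is
   not absolutely continuous with respect to [Q]. The terms with P(y) = 0 do not
   contribute; if P << Q then Q(y) > 0 wherever P(y) > 0. *)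
Definition kl_div (R : realType) (Y : pointedType)
    (P Q : probability (discrete Y) R) : \bar R :=
  if `[< P `<< Q >]
  then (\int[P]_y (ln (fine (P [set y]) / fine (Q [set y])))%:E)%E
  else +oo%E.

Definition gradient (R : realType) (p : nat) (f : 'rV[R]_p -> R)
    (theta : 'rV[R]_p) : 'rV[R]_p :=
  \row_(i < p) 'D_(delta_mx 0 i) f theta.

Definition has_gradient (R : realType) (p : nat) (f : 'rV[R]_p -> R)
    (theta : 'rV[R]_p) : Prop :=
  forall i : 'I_p, derivable f theta (delta_mx 0 i).

(* Main.v *)
Require Import Defs.
From mathcomp Require Import all_boot all_order all_algebra.
From mathcomp Require Import all_classical all_reals all_analysis.

Import Order.TTheory GRing.Theory Num.Theory.
Import numFieldNormedType.Exports.

Local Open Scope classical_set_scope.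
Local Open Scope ring_scope.

(** Each reward [r x] factors through [tgt], so its mean under a policy is the mean of [rt x] under
    the pushforward law, by change of variables ([expectation_target_law]). At a fixed parameter the
    KL penalty is constant in the response, so the penalized reward factors in the same way. The two
    objectives are therefore the same function of the parameter, and so are their gradients. *)

Lemma expectation_target_law (R : realType) (Y T : pointedType) (tgt : Y -> T)
    (P : probability (discrete Y) R) (f : T -> R) :
  ('E_(target_law tgt P)[f : discrete T -> R] =
   'E_P[(f \o tgt) : discrete Y -> R])%E.
Proof.
rewrite unlock integralE [RHS]integralE.
(* The positive and negative parts are transported separately by the change of variables for
   nonnegative functions; measurability is automatic for the discrete sigma-algebra. *)
rewrite !ge0_integral_pushforward//=.
by congr (_ - _)%E; apply: eq_integral => y _; rewrite !(funeposE, funenegE).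
Qed.

Theorem theorem3p3 (R : realType) (X : Type) (Y T : pointedType)
  (countableY : countable [set: Y])
  (tgt : Y -> T)
  (r : X -> Y -> R) (rt : X -> T -> R)
  (reward_target : forall (x : X) (y : Y), r x y = rt x (tgt y))
  (p : nat) (pi_ : 'rV[R]_p -> policy R X Y) (pi_ref : policy R X Y)
  (beta : R) (beta_gt0 : 0 < beta)
  (reward_integrable : forall (theta : 'rV[R]_p) (x : X),
     (pi_ theta x).-integrable [set: discrete Y] (EFin \o r x))
  (kl_finite : forall (theta : 'rV[R]_p) (x : X),
     kl_div (pi_ theta x) (pi_ref x) \is a fin_num)
  (gradient_exists : forall (x : X) (theta : 'rV[R]_p),
     has_gradient (fun th : 'rV[R]_p =>
       fine 'E_(pi_ th x)[fun y : discrete Y =>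
         r x y - beta * fine (kl_div (pi_ th x) (pi_ref x))]) theta) :
  (forall (x : X) (theta : 'rV[R]_p),
     ('E_(pi_ theta x)[r x] = 'E_(target_law tgt (pi_ theta x))[rt x])%E)
  /\
  (forall (x : X) (theta : 'rV[R]_p),
     gradient (fun th : 'rV[R]_p =>
       fine 'E_(pi_ th x)[fun y : discrete Y =>
         r x y - beta * fine (kl_div (pi_ th x) (pi_ref x))]) theta
     =
     gradient (fun th : 'rV[R]_p =>
       fine 'E_(target_law tgt (pi_ th x))[fun yt : discrete T =>
         rt x yt - beta * fine (kl_div (pi_ th x) (pi_ref x))]) theta).
Proof.
(* As an equality of functions, this can be rewritten under the binder of [y] in the penalized
   reward. *)
have rE x : r x = rt x \o tgt by apply/funext => y; exact: reward_target.
split=> x theta; first by rewrite expectation_target_law rE.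
(* The objectives are compared at every parameter [th], not only at [theta], as a derivative
   requires. *)
congr gradient; apply/funext => th; congr fine.
by rewrite expectation_target_law rE.
Qed.
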